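(* Let $\mathrm{Pal}(x)$ be the palinomial induced by a shifted-symmetric $(n,b)$-palintiple $(d_k,d_{k-1},\ldots,d_0)_b$ with carries $c_k,c_{k-1},\ldots,c_1,c_0$, and let $D$ and $\overline{D}$ denote its digit and reverse-digit polynomials, respectively. Then $$D(x)=(d_kx+d_0)\,\frac{\mathrm{Pal}(x)}{c_k(x-b)}\quad\text{and}\quad \overline{D}(x)=(d_0x+d_k)\,\frac{\mathrm{Pal}(x)}{c_k(x-b)}.$$
   Context: For integers $1<n<b$ and $k\ge 1$, write $(d_k,\ldots,d_0)_b=\sum_{j=0}^k d_jb^j$ with digits $0\le d_j<b$. It is called a $(k+1)$-digit $(n,b)$-palintiple (with multiplier $n$ and base $b$) if $d_k\neq 0$ (no leading zeros) and $(d_k,d_{k-1},\ldots,d_0)_b=n\,(d_0,d_1,\ldots,d_k)_b$. Its carries $c_k,\ldots,c_0$ are those of the base-$b$ single-digit multiplication: $c_0=0$ and $n d_{k-j}+c_j=d_j+b\,c_{j+1}$ for $0\le j\le k$, with $c_{k+1}=0$. The palintiple is shifted-symmetric if $c_j=c_{k-j+1}$ for all $0\le j\le k$ (in this case $c_k=c_1\neq 0$). The palinomial induced by an $(n,b)$-palintiple $(d_k,\ldots,d_0)_b$ is $\mathrm{Pal}(x)=\sum_{j=0}^k(d_j-nd_{k-j})x^j$; it is divisible by $x-b$. The digit polynomial is $D(x)=\sum_{j=0}^k d_jx^j$ and the reverse-digit polynomial is $\overline{D}(x)=\sum_{j=0}^k d_{k-j}x^j$. *)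

(* Defs.v *)
From mathcomp Require Import all_boot all_order all_algebra.
Set Implicit Arguments.
Unset Strict Implicit.
Unset Printing Implicit Defensive.
Import GRing.Theory.
Local Open Scope ring_scope.

(* A (k+1)-digit string is d : nat -> nat, with d j the digit of weight b ^ j;
   only the values d 0, ..., d k are ever used. *)
Definition base_value (b k : nat) (d : nat -> nat) : nat :=
  (\sum_(j < k.+1) d j * b ^ j)%N.

Definition rev_digits (k : nat) (d : nat -> nat) : nat -> nat :=
  fun j => d (k - j)%N.

Definition palintiple (n b k : nat) (d : nat -> nat) : Prop :=
  [/\ forall j, (j <= k)%N -> (d j < b)%N,
      d k <> 0%N
    & base_value b k d = (n * base_value b k (rev_digits k d))%N].

(* c_0, ..., c_(k+1) are the carries of the base-b multiplication by n of the
   reversed string, whose digits are d_k, ..., d_0 from the units upwards; the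
   product has digits d_0, ..., d_k and no carry is left over. *)
Definition carries (n b k : nat) (d c : nat -> nat) : Prop :=
  [/\ c 0%N = 0%N, c k.+1 = 0%N
    & forall j, (j <= k)%N ->
        (n * rev_digits k d j + c j = d j + b * c j.+1)%N].

Definition shifted_symmetric (k : nat) (c : nat -> nat) : Prop :=
  forall j, (j <= k)%N -> c j = c (k - j + 1)%N.

Definition palinomial (n k : nat) (d : nat -> nat) : {poly rat} :=
  \sum_(j < k.+1) ((d j)%:R - n%:R * (rev_digits k d j)%:R) *: 'X^j.

Definition digit_poly (k : nat) (d : nat -> nat) : {poly rat} :=
  \sum_(j < k.+1) (d j)%:R *: 'X^j.

Definition rev_digit_poly (k : nat) (d : nat -> nat) : {poly rat} :=
  digit_poly k (rev_digits k d).

(* Canonical embedding of Q[x] into its fraction field Q(x). *)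
Notation toQx := (@FracField.tofrac {poly rat}).

(* Main.v *)
Require Import Defs.
From mathcomp Require Import all_boot all_order all_algebra.
From mathcomp Require Import zify lra.
Set Implicit Arguments.
Unset Strict Implicit.
Import GRing.Theory.
Local Open Scope ring_scope.

(** The carries [c_1, ..., c_k] are, up to [x - b], the coefficients of the
    palinomial: the carry recurrence reads [d_j - n d_(k-j) = c_j - b c_(j+1)],
    and since [c_0 = c_(k+1) = 0] this says [Pal(x) = (x - b) C(x)] where
    [C(x) = c_1 + c_2 x + ... + c_k x^(k-1)].  The theorem thus amounts to
    [c_k D(x) = (d_k x + d_0) C(x)] and its mirror image, that is, to the
    coefficientwise identity [c_k d_j = d_k c_j + d_0 c_(j+1)].

    Shifted symmetry turns the recurrence at [k - j] into a second linear
    relation between [d_j], [d_(k-j)], [c_j] and [c_(j+1)].  Eliminating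
    [d_(k-j)] gives [(n^2 - 1) d_j = (n b - 1) c_j + (b - n) c_(j+1)]
    ([digit_of_carries]).  At [j = k] and [j = 0] this evaluates [d_k] and
    [d_0] as multiples of [c_k = c_1], so the two coefficients on the right are
    [(n^2 - 1) d_k / c_k] and [(n^2 - 1) d_0 / c_k]; cancelling [n^2 - 1]
    yields the identity ([digit_carry_relation]). *)

Definition carry_poly (k : nat) (c : nat -> nat) : {poly rat} :=
  \sum_(j < k) (c j.+1)%:R *: 'X^j.

(** Because the carries vanish at both ends, [sum_j c_j x^j] and
    [sum_j c_(j+1) x^j] are [x C(x)] and [C(x)].  Both the palinomial
    and the digit polynomials are linear combinations of these two sums. *)
Lemma linear_mul_carry_poly (k : nat) (c : nat -> nat) (u v : rat) :
  c 0%N = 0%N -> c k.+1 = 0%N ->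
  \sum_(j < k.+1) (u * (c j)%:R + v * (c j.+1)%:R) *: 'X^j =
    (u *: 'X + v%:P) * carry_poly k c.
Proof.
move=> c0 ck1.
have -> : \sum_(j < k.+1) (u * (c j)%:R + v * (c j.+1)%:R) *: 'X^j =
    u *: (\sum_(j < k.+1) (c j)%:R *: 'X^j) +
    v *: (\sum_(j < k.+1) (c j.+1)%:R *: 'X^j) :> {poly rat}.
  rewrite !scaler_sumr -big_split /=; apply: eq_bigr => j _.
  by rewrite !scalerA -scalerDl.
rewrite mulrDl mul_polyC -scalerAl; congr (_ *: _ + _ *: _).
  rewrite big_ord_recl c0 scale0r add0r /carry_poly mulr_sumr.
  by apply: eq_bigr => j _; rewrite exprS scalerAr.
by rewrite big_ord_recr /= ck1 scale0r addr0.
Qed.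

Lemma palinomial_factor (n b k : nat) (d c : nat -> nat) :
  carries n b k d c -> palinomial n k d = ('X - b%:R%:P) * carry_poly k c.
Proof.
case=> c0 ck1 rec.
have -> : 'X - b%:R%:P = 1 *: 'X + (- b%:R)%:P :> {poly rat}.
  by rewrite scale1r polyCN.
rewrite -linear_mul_carry_poly //; apply: eq_bigr => j _; congr (_ *: _).
have /(congr1 (fun m : nat => m%:R : rat)) := rec j (ltn_ord j).
rewrite !natrD !natrM => E.
lra.
Qed.

(** The recurrences at [j] and at [k - j] form a linear system for [d_j] and
    [d_(k-j)]; its determinant is [n^2 - 1] up to sign.  It is stated without
    subtraction so as to stay in the natural numbers. *)
Lemma digit_of_carries (n b k : nat) (d c : nat -> nat) (j : nat) :
  carries n b k d c -> shifted_symmetric k c -> (j <= k)%N ->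
  (n * n * d j + c j + n * c j.+1 = d j + n * b * c j + b * c j.+1)%N.
Proof.
move=> [_ _ rec] sym le_jk.
have rec_j := rec j le_jk; have rec_kj := rec (k - j)%N (leq_subr j k).
have c_kj : c (k - j)%N = c j.+1.
  by rewrite (sym _ (leq_subr j k)) subKn // addn1.
have c_kj1 : c (k - j).+1 = c j by rewrite -addn1 -sym.
rewrite /rev_digits subKn // c_kj c_kj1 in rec_kj.
rewrite /rev_digits in rec_j.
have : (n * (n * d j + c j.+1) = n * (d (k - j) + b * c j))%N by rewrite rec_kj.
lia.
Qed.

Lemma carries_sym1 (k : nat) (c : nat -> nat) :
  (1 <= k)%N -> shifted_symmetric k c -> c 1%N = c k.
Proof. by move=> hk /(_ 1%N hk); rewrite subn1 addn1 prednK. Qed.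

Lemma last_carry_neq0 (n b k : nat) (d c : nat -> nat) :
  (1 < n)%N -> d k <> 0%N -> carries n b k d c -> shifted_symmetric k c ->
  c k <> 0%N.
Proof.
move=> hn dk hcar sym ck.
have [_ ck1 _] := hcar.
have := digit_of_carries hcar sym (leqnn k); rewrite ck ck1 !muln0 !addn0.
have n2_gt1 : (1 < n * n)%N by nia.
by rewrite -[RHS]mul1n => /eqP; rewrite eqn_pmul2r ?lt0n; lia.
Qed.

Lemma digit_carry_relation (n b k : nat) (d c : nat -> nat) (j : nat) :
  (1 < n)%N -> (1 <= k)%N -> carries n b k d c -> shifted_symmetric k c ->
  (j <= k)%N -> (c k * d j = d k * c j + d 0 * c j.+1)%N.
Proof.
move=> hn hk hcar sym le_jk; have [c0 ck1 _] := hcar.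
have Ej := digit_of_carries hcar sym le_jk.
have Ek := digit_of_carries hcar sym (leqnn k).
have E0 := digit_of_carries hcar sym (leq0n k).
rewrite ck1 in Ek; rewrite c0 (carries_sym1 hk sym) in E0.
move: Ej Ek E0 => /(congr1 Posz) Ej /(congr1 Posz) Ek /(congr1 Posz) E0.
rewrite !(PoszD, PoszM) in Ej Ek E0.
apply/eqP; rewrite -eqz_nat !(PoszD, PoszM) -subr_eq0.
have n2 : (n%:Z ^+ 2 - 1 != 0)%R by nia.
apply/eqP; apply: (mulfI n2); rewrite mulr0.
(* Combine the elimination formulas at j, k and 0 with multipliers c_k, c_j
   and c_(j+1). *)
have Ej' := congr1 (fun z => z * (c k)%:Z) Ej.
have Ek' := congr1 (fun z => z * (c j)%:Z) Ek.
have E0' := congr1 (fun z => z * (c j.+1)%:Z) E0.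
lra.
Qed.

(** The string [e] is kept arbitrary because the argument is applied both to
    [d] and to its reversal, with the roles of [d_k] and [d_0] exchanged.
    Both sides become [(u x + v) (x - b) C(x)] on clearing the denominator. *)
Lemma digit_poly_fraction (n b k : nat) (d c e : nat -> nat) (u v : nat) :
  carries n b k d c -> c k <> 0%N ->
  (forall j, (j <= k)%N -> (c k * e j = u * c j + v * c j.+1)%N) ->
  toQx (digit_poly k e) =
    toQx (u%:R *: 'X + v%:R%:P) *
      (toQx (palinomial n k d) / toQx ((c k)%:R *: ('X - b%:R%:P))).
Proof.
move=> hcar ck rel; have [c0 ck1 _] := hcar.
have digitE : (c k)%:R *: digit_poly k e =
    (u%:R *: 'X + v%:R%:P) * carry_poly k c.
  rewrite -linear_mul_carry_poly // scaler_sumr; apply: eq_bigr => j _.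
  by rewrite scalerA -!natrM -natrD rel // -ltnS.
have den_neq0 : (c k)%:R *: ('X - b%:R%:P) != 0 :> {poly rat}.
  by rewrite scaler_eq0 polyXsubC_eq0 orbF Num.Theory.pnatr_eq0; apply/eqP.
have toQx_den_neq0 : toQx ((c k)%:R *: ('X - b%:R%:P)) != 0.
  by rewrite tofrac_eq0.
rewrite mulrA; apply: (canRL (mulfK toQx_den_neq0)).
rewrite -!tofracM (palinomial_factor hcar) mulrCA -digitE.
by rewrite -!scalerAr mulrC.
Qed.

Theorem theorem11 (n b k : nat) (d c : nat -> nat)
  (hn : (1 < n)%N) (hnb : (n < b)%N) (hk : (1 <= k)%N)
  (hpal : palintiple n b k d)
  (hcar : carries n b k d c)
  (hsym : shifted_symmetric k c) :
  toQx (digit_poly k d) =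
    toQx ((d k)%:R *: 'X + (d 0%N)%:R%:P) *
      (toQx (palinomial n k d) / toQx ((c k)%:R *: ('X - b%:R%:P)))
  /\
  toQx (rev_digit_poly k d) =
    toQx ((d 0%N)%:R *: 'X + (d k)%:R%:P) *
      (toQx (palinomial n k d) / toQx ((c k)%:R *: ('X - b%:R%:P))).
Proof.
have [_ dk _] := hpal.
have ck := last_carry_neq0 hn dk hcar hsym.
have rel j := @digit_carry_relation _ _ _ _ _ j hn hk hcar hsym.
split; first by apply: digit_poly_fraction => // j; apply: rel.
apply: digit_poly_fraction => // j le_jk.
(* Reversal j -> k - j exchanges c_j with c_(j+1), hence d_k with d_0. *)
rewrite /rev_digits rel ?leq_subr // (hsym (k - j)%N) ?leq_subr // subKn //.
by rewrite addn1 -[(k - j).+1]addn1 -hsym // addnC.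
Qed.
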